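(* Let $D$ be a finite set with $m+1$ elements ($m\ge1$), $n\ge1$, and $u:D^n\times D^n\to\mathbb{R}$. Let $\{X_{\mathbf{d}}\mid\mathbf{d}\in D^n\}$ be the discrete exponential mechanism with utility $u$ (i.e. $\mathbb{P}(X_{\mathbf{d}}=\mathbf{d}')=C_{\mathbf{d}}^{-1}e^{u(\mathbf{d},\mathbf{d}')}$ with $C_{\mathbf{d}}=\sum_{\mathbf{d}'\in D^n}e^{u(\mathbf{d},\mathbf{d}')}$), and assume $C_{\mathbf{d}}=C$ is the same for all $\mathbf{d}\in D^n$. Fix $\epsilon\ge0$, $0\le\delta\le1$ and neighbours $\mathbf{d}\sim\mathbf{d}'$. Let $S_{\mathbf{d},\mathbf{d}'}=\{\mathbf{d}^*\in D^n\mid \mathbb{P}(X_{\mathbf{d}}=\mathbf{d}^* )>\mathbb{P}(X_{\mathbf{d}'}=\mathbf{d}^* )\}$, let $0<\alpha_1<\dots<\alpha_s$ be the distinct values of $u(\mathbf{d},\mathbf{d}^* )-u(\mathbf{d}',\mathbf{d}^* )$ for $\mathbf{d}^*\in S_{\mathbf{d},\mathbf{d}'}$, and for each $i$ let $\tilde S^i_{\mathbf{d},\mathbf{d}'}=\{\mathbf{d}^*\in S_{\mathbf{d},\mathbf{d}'}\mid u(\mathbf{d},\mathbf{d}^* )-u(\mathbf{d}',\mathbf{d}^* )=\alpha_i\}$. For each $i$: if $\mathbb{P}(X_{\mathbf{d}}\in \tilde S^i_{\mathbf{d},\mathbf{d}'})\le e^{\epsilon}\mathbb{P}(X_{\mathbf{d}'}\in\tilde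 S^i_{\mathbf{d},\mathbf{d}'})+\delta$, then $\mathbb{P}(X_{\mathbf{d}}\in A)\le e^{\epsilon}\mathbb{P}(X_{\mathbf{d}'}\in A)+\delta$ for all $A\subseteq\tilde S^i_{\mathbf{d},\mathbf{d}'}$.
   Context: Databases are vectors in $D^n$; the Hamming distance $h(\mathbf{d},\mathbf{d}')$ is the number of coordinates where they differ, and $\mathbf{d}\sim\mathbf{d}'$ (neighbours) means $h(\mathbf{d},\mathbf{d}')=1$. All $X_{\mathbf{d}}$ are $D^n$-valued random variables on a common probability space. *)

(* Defs.v *)
From HB Require Import structures.
From mathcomp Require Export all_boot all_order all_algebra.
From mathcomp Require Export all_classical all_reals all_analysis.

Set Implicit Arguments.
Unset Strict Implicit.
Unset Printing Implicit Defensive.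

Import Order.TTheory GRing.Theory Num.Theory.
Import numFieldNormedType.Exports.

Local Open Scope classical_set_scope.
Local Open Scope ring_scope.

Definition database (D : finType) (n : nat) : finType := {ffun 'I_n -> D}.

Definition hamming (D : finType) (n : nat) (d d' : database D n) : nat :=
  #|[pred i : 'I_n | d i != d' i]|.

Definition neighbours (D : finType) (n : nat) (d d' : database D n) : Prop :=
  hamming d d' = 1%N.

(* Measurability with respect to the discrete sigma-algebra on the finite
   type [S]. This is [measurable_fun setT X], unfolded because a
   [measurableType] must be pointed and an arbitrary finType is not. *)
Definition finite_random_variable (disp : measure_display)
    (T : measurableType disp) (S : finType) (X : T -> S) : Prop :=
  forall A : set S, measurable (X @^-1` A).

Definition Pr (R : realType) (disp : measure_display) (T : measurableType disp)
    (P : probability T R) (S : finType) (X : T -> S) (A : set S) : \bar R :=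
  P (X @^-1` A).

Definition norm_const (R : realType) (D : finType) (n : nat)
    (u : database D n -> database D n -> R) (d : database D n) : R :=
  \sum_(d' : database D n) expR (u d d').

Definition exponential_mechanism (R : realType) (D : finType) (n : nat)
    (u : database D n -> database D n -> R) (disp : measure_display)
    (T : measurableType disp) (P : probability T R)
    (X : database D n -> T -> database D n) : Prop :=
  (forall d, finite_random_variable (X d)) /\
  (forall d d', Pr P (X d) [set d'] =
                ((norm_const u d)^-1 * expR (u d d'))%:E).

Definition dom_set (R : realType) (D : finType) (n : nat)
    (disp : measure_display) (T : measurableType disp) (P : probability T R)
    (X : database D n -> T -> database D n) (d d' : database D n) :
    set (database D n) :=
  [set x | (Pr P (X d') [set x] < Pr P (X d) [set x])%E].

Definition level_set (R : realType) (D : finType) (n : nat)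
    (u : database D n -> database D n -> R) (disp : measure_display)
    (T : measurableType disp) (P : probability T R)
    (X : database D n -> T -> database D n) (d d' : database D n) (a : R) :
    set (database D n) :=
  [set x | dom_set P X d d' x /\ u d x - u d' x = a].

(* Main.v *)
(** All points of a level set have the same likelihood ratio [expR a], so on its
subsets the law of [X d] is [expR a] times that of [X d']. The gap
[P (X d \in A) - expR eps * P (X d' \in A)] is therefore the fixed multiple
[expR a - expR eps] of [P (X d' \in A)]: it is nonpositive, or else monotone in
[A] and hence largest on the whole level set. *)

Require Import Defs.

Import Order.TTheory GRing.Theory Num.Theory.
Import numFieldNormedType.Exports.

Local Open Scope classical_set_scope.
Local Open Scope ring_scope.

Section FiniteLaw.
Context {R : realType} {disp : measure_display} {T : measurableType disp}.
Context (P : probability T R) {S : finType}.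

Lemma Pr_ge0 (X : T -> S) (A : set S) : (0 <= Pr P X A)%E.
Proof. exact: measure_ge0. Qed.

Lemma Pr_fin_num {X : T -> S} (A : set S) :
  finite_random_variable X -> Pr P X A \is a fin_num.
Proof. by move=> mX; apply: fin_num_measure; apply: mX. Qed.

Lemma le_Pr {X : T -> S} {A B : set S} :
  finite_random_variable X -> A `<=` B -> (Pr P X A <= Pr P X B)%E.
Proof.
move=> mX AB; apply: le_measure; rewrite ?inE; [exact: mX|exact: mX|].
exact: preimage_subset.
Qed.

Lemma Pr_fsum (X : T -> S) (A : set S) : finite_random_variable X ->
  Pr P X A = (\sum_(x \in A) Pr P X [set x])%E.
Proof.
move=> mX; rewrite /Pr -[in LHS](image_id A) -bigcup_imset1 preimage_bigcup.
apply: measure_fin_bigcup => [||x _]; [exact: finite_finset| |exact: mX].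
by move=> x y _ _ [t [/= -> ->]].
Qed.

Lemma Pr_scale (X Y : T -> S) (c : R) (A : set S) :
  finite_random_variable X -> finite_random_variable Y ->
  (forall x, A x -> Pr P X [set x] = c%:E * Pr P Y [set x])%E ->
  Pr P X A = (c%:E * Pr P Y A)%E.
Proof.
(* In [\bar R] the factor [c] distributes over the sum because all point masses are nonnegative. *)
move=> mX mY XY; rewrite !Pr_fsum// ge0_mule_fsumr => [|x]; last exact: Pr_ge0.
by apply: eq_fsbigr => x /set_mem; exact: XY.
Qed.

End FiniteLaw.

(** Equal normalising constants cancel in the likelihood ratio, leaving only the quotient of the two
    exponentials. *)
Lemma exponential_mechanism_ratio (R : realType) (D : finType) (n : nat)
    (u : database D n -> database D n -> R)
    (disp : measure_display) (T : measurableType disp) (P : probability T R)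
    (X : database D n -> T -> database D n) (d d' x : database D n) :
  exponential_mechanism u P X -> norm_const u d = norm_const u d' ->
  Pr P (X d) [set x] = ((expR (u d x - u d' x))%:E * Pr P (X d') [set x])%E.
Proof.
move=> [_ PX] Cdd'; rewrite !PX Cdd' -EFinM; congr (_%:E).
by rewrite mulrCA -expRD subrK.
Qed.

(** The real-number core: [a] stands for [expR (alpha i)], [e] for [expR eps], [t] for [delta], and
    [p], [q] for the masses under [X d'] of [A] and of the whole level set. *)
Lemma le_affine_mono (R : realDomainType) (a e t p q : R) :
  0 <= t -> 0 <= p -> p <= q -> a * q <= e * q + t -> a * p <= e * p + t.
Proof.
(* Both inequalities now bound a multiple of [a - e] by [t]; the sign of [a - e] decides the
   case. *)
move=> t0 p0 pq; rewrite -!lerBlDl -!mulrBl => aq.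
have [ae|ea] := leP a e.
  by apply: le_trans t0; apply: mulr_le0_ge0 => //; rewrite subr_le0.
by apply: le_trans aq; apply: ler_wpM2l pq; rewrite subr_ge0 ltW.
Qed.

Theorem theorem3 (R : realType) (D : finType) (m n : nat)
    (m_ge1 : (1 <= m)%N) (card_D : #|D| = m.+1) (n_ge1 : (1 <= n)%N)
    (u : database D n -> database D n -> R)
    (disp : measure_display) (T : measurableType disp) (P : probability T R)
    (X : database D n -> T -> database D n)
    (X_exp : exponential_mechanism u P X)
    (C : R) (C_const : forall d : database D n, norm_const u d = C)
    (eps delta : R) (eps_ge0 : 0 <= eps)
    (delta_ge0 : 0 <= delta) (delta_le1 : delta <= 1)
    (d d' : database D n) (d_d' : neighbours d d')
    (s : nat) (alpha : 'I_s -> R)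
    (alpha_gt0 : forall i : 'I_s, 0 < alpha i)
    (alpha_incr : forall i j : 'I_s, (i < j)%N -> alpha i < alpha j)
    (alpha_values :
       range alpha = [set u d x - u d' x | x in dom_set P X d d']) :
  forall i : 'I_s,
    (Pr P (X d) (level_set u P X d d' (alpha i)) <=
       (expR eps)%:E * Pr P (X d') (level_set u P X d d' (alpha i)) + delta%:E)%E ->
    forall A : set (database D n),
      A `<=` level_set u P X d d' (alpha i) ->
      (Pr P (X d) A <= (expR eps)%:E * Pr P (X d') A + delta%:E)%E.
Proof.
move=> i lvl A Ai.
have mX := X_exp.1.
(* Stated for every [B] because it serves both [A] and the level set itself. *)
have scale B : B `<=` level_set u P X d d' (alpha i) ->
    Pr P (X d) B = ((expR (alpha i))%:E * Pr P (X d') B)%E.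
  move=> Bi; apply: Pr_scale; [exact: mX|exact: mX|move=> x].
  move=> /Bi[_ <-]; apply: exponential_mechanism_ratio X_exp _.
  by rewrite !C_const.
move: (le_Pr P (mX d') Ai) (Pr_ge0 P (X d') A) lvl.
rewrite !scale//.
(* Probabilities are finite, so the inequalities descend from [\bar R] to [R]. *)
rewrite -(fineK (Pr_fin_num P A (mX d'))).
rewrite -(fineK (Pr_fin_num P (level_set u P X d d' (alpha i)) (mX d'))).
rewrite -!EFinM -!EFinD !lee_fin => pq p0.
exact: le_affine_mono.
Qed.
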